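(* Suppose that $\varphi:\mathbb{R}^n\times\mathbb{R}^m\to\mathbb{R}\cup\{\infty\}$ is twice continuously differentiable and $\sigma$-convex-concave for some $\sigma\in\mathbb{R}$, i.e. $\nabla^2_{xx}\varphi(z)\succeq\sigma\mathrm{I}$ and $-\nabla^2_{yy}\varphi(z)\succeq\sigma\mathrm{I}$ for all $z\in\mathbb{R}^{n+m}$. Moreover, suppose the $\alpha$-interaction dominance condition holds for some $\alpha>-\tfrac1\delta$ and $\delta\in\big(0,\tfrac{1}{[-\sigma]_+}\big)$, i.e. for all $z\in\mathbb{R}^{n+m}$ $$\nabla^2_{xx}\varphi(z)+\nabla^2_{xy}\varphi(z)\big(\tfrac1\delta\mathrm{I}-\nabla^2_{yy}\varphi(z)\big)^{-1}\nabla^2_{yx}\varphi(z)\succeq\alpha\mathrm{I},$$ $$-\nabla^2_{yy}\varphi(z)+\nabla^2_{yx}\varphi(z)\big(\tfrac1\delta\mathrm{I}+\nabla^2_{xx}\varphi(z)\big)^{-1}\nabla^2_{xy}\varphi(z)\succeq\alpha\mathrm{I}.$$ Then the following hold for the associated saddle operator $T_\varphi(z):=\big(\nabla_x\varphi(z),-\nabla_y\varphi(z)\big)$. (i) If $\alpha<\tfrac1\delta$, then $T_\varphi$ is $\big(\tfrac{\alpha}{1-\alpha\delta},-\tfrac{\delta}{1-\alpha\delta}\big)$-semimonotone. (ii) If $\alpha\ge0$, then $T_\varphi$ is $(0,-\delta)$-semimonotone.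
   Context: $z=(x,y)\in\mathbb{R}^n\times\mathbb{R}^m$. $[t]_+=\max\{0,t\}$, and $1/[-\sigma]_+$ is read as $+\infty$ when $[-\sigma]_+=0$. An operator $T$ is $(\mu,\rho)$-semimonotone if $\langle z-z',v-v'\rangle\ge\mu\|z-z'\|^2+\rho\|v-v'\|^2$ for all $(z,v),(z',v')$ in its graph. *)

(* Defs.v *)
From HB Require Import structures.
From mathcomp Require Import all_boot all_order all_algebra.
From mathcomp Require Import all_classical all_reals all_analysis.

Set Implicit Arguments.
Unset Strict Implicit.
Unset Printing Implicit Defensive.

Import Order.TTheory GRing.Theory Num.Theory numFieldNormedType.Exports.

Local Open Scope classical_set_scope.
Local Open Scope ring_scope.

(* Points z = (x, y) of R^n x R^m are row vectors row_mx x y : 'rV[R]_(n + m). *)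

(* The Euclidean inner product.  The library norm `|z| on matrices is the
   sup norm, so the squared Euclidean norm is written dotv z z. *)
Definition dotv (R : realType) (d : nat) (u v : 'rV[R]_d) : R :=
  \sum_(i < d) u 0 i * v 0 i.

(* Operators are set-valued: v \in T z means that (z, v) is in the graph. *)
Definition semimonotone (R : realType) (d : nat) (mu rho : R)
    (T : 'rV[R]_d -> set 'rV[R]_d) : Prop :=
  forall z v z' v' : 'rV[R]_d, T z v -> T z' v' ->
    mu * dotv (z - z') (z - z') + rho * dotv (v - v') (v - v')
      <= dotv (z - z') (v - v').

Definition gradient (R : realType) (d : nat) (f : 'rV[R]_d -> R)
    (z : 'rV[R]_d) : 'rV[R]_d :=
  \row_(i < d) 'D_(delta_mx 0 i) f z.

(* Since 'J acts on row vectors, the (i, j) entry is D_i (D_j f) z. *)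
Definition hessian (R : realType) (d : nat) (f : 'rV[R]_d -> R)
    (z : 'rV[R]_d) : 'M[R]_d :=
  'J (gradient f) z.

(* Differentiability of an extended real-valued function at every point
   entails finiteness at every point. *)
Definition twice_continuously_differentiable (R : realType) (d : nat)
    (phi : 'rV[R]_d -> \bar R) : Prop :=
  [/\ forall z, phi z \is a fin_num,
      forall z, differentiable (fine \o phi) z,
      forall z, differentiable (gradient (fine \o phi)) z
    & continuous (hessian (fine \o phi))].

Definition grad_x (R : realType) (n m : nat)
    (phi : 'rV[R]_(n + m) -> \bar R) (z : 'rV[R]_(n + m)) : 'rV[R]_n :=
  lsubmx (gradient (fine \o phi) z).
Definition grad_y (R : realType) (n m : nat)
    (phi : 'rV[R]_(n + m) -> \bar R) (z : 'rV[R]_(n + m)) : 'rV[R]_m :=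
  rsubmx (gradient (fine \o phi) z).

Definition hess_xx (R : realType) (n m : nat)
    (phi : 'rV[R]_(n + m) -> \bar R) (z : 'rV[R]_(n + m)) : 'M[R]_n :=
  ulsubmx (hessian (fine \o phi) z).
Definition hess_xy (R : realType) (n m : nat)
    (phi : 'rV[R]_(n + m) -> \bar R) (z : 'rV[R]_(n + m)) : 'M[R]_(n, m) :=
  ursubmx (hessian (fine \o phi) z).
Definition hess_yx (R : realType) (n m : nat)
    (phi : 'rV[R]_(n + m) -> \bar R) (z : 'rV[R]_(n + m)) : 'M[R]_(m, n) :=
  dlsubmx (hessian (fine \o phi) z).
Definition hess_yy (R : realType) (n m : nat)
    (phi : 'rV[R]_(n + m) -> \bar R) (z : 'rV[R]_(n + m)) : 'M[R]_m :=
  drsubmx (hessian (fine \o phi) z).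

Definition saddle_operator (R : realType) (n m : nat)
    (phi : 'rV[R]_(n + m) -> \bar R) (z : 'rV[R]_(n + m)) : set 'rV[R]_(n + m) :=
  [set row_mx (grad_x phi z) (- grad_y phi z)].

(* The Loewner order A >= B.  It is only applied to matrices that are
   symmetric when phi is C^2, so symmetry is not required separately. *)
Definition loewner_ge (R : realType) (d : nat) (A B : 'M[R]_d) : Prop :=
  forall u : 'rV[R]_d, 0 <= (u *m (A - B) *m u^T) 0 0.

Definition convex_concave (R : realType) (n m : nat) (sigma : R)
    (phi : 'rV[R]_(n + m) -> \bar R) : Prop :=
  forall z, loewner_ge (hess_xx phi z) sigma%:M /\
            loewner_ge (- hess_yy phi z) sigma%:M.

(* invmx A is A itself when A is singular; this does not occur when phi is
   sigma-convex-concave and 0 < delta < 1 / [- sigma]_+, because then both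
   inverted matrices are bounded below by (delta^-1 + sigma) I, which is
   positive definite. *)
Definition interaction_dominance (R : realType) (n m : nat) (alpha delta : R)
    (phi : 'rV[R]_(n + m) -> \bar R) : Prop :=
  forall z,
    loewner_ge
      (hess_xx phi z
       + hess_xy phi z *m invmx ((delta^-1)%:M - hess_yy phi z)
         *m hess_yx phi z)
      alpha%:M /\
    loewner_ge
      (- hess_yy phi z
       + hess_yx phi z *m invmx ((delta^-1)%:M + hess_xx phi z)
         *m hess_xy phi z)
      alpha%:M.

Definition pos_part (R : realType) (t : R) : R := Num.max 0 t.

(* Main.v *)
Require Import Defs.
From HB Require Import structures.
From mathcomp Require Import all_boot all_order all_algebra.
From mathcomp Require Import all_classical all_reals all_analysis.
From mathcomp Require Import ring lra.
Import Order.TTheory GRing.Theory Num.Theory numFieldNormedType.Exports.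
Local Open Scope ring_scope.

(** Both claimed inequalities follow from a single property of the shifted
operator W z = z / delta + T z, where T = (grad_x phi, - grad_y phi), namely that
the inverse of W is cocoercive:

  kappa <W w - W z, w - z>  <=  |W w - W z|^2,  where kappa = 1/delta + alpha.

Substituting W w - W z = (w - z) / delta + (T w - T z) and expanding gives (i)
after multiplication by delta / (1 - alpha delta); for alpha >= 0, dropping
alpha <W w - W z, w - z> >= 0 from the left-hand side gives (ii).  (Up to a
rescaling of the argument, T o W^-1 is the saddle operator of the saddle envelope
of phi, and the inequality says that it is strongly monotone with modulus
alpha / (1 + alpha delta), which may be negative.)

The infinitesimal version holds at every point z.  The derivative of W is the
block matrix L with diagonal blocks P = 1/delta + phi_xx and
Q = 1/delta - phi_yy, and off-diagonal blocks - B and B^T with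
B = phi_xy, because the Hessian is symmetric (hessian_sym).  The symmetric part of
L^-1 is then block diagonal, with blocks the inverses of the Schur complements
P + B Q^-1 B^T and Q + B^T P^-1 B, and alpha-interaction dominance says precisely
that these Schur complements are at least 1/delta + alpha
(saddle_block_inverse_cocoercive).

The inequality |L h|^2 >= kappa <L h, h> is not preserved when L is averaged along
a segment from z to w, so it has to be integrated along the preimage under W of
the segment from W z to W w instead: there the increment of W is the fixed vector
W w - W z, and the inequality becomes linear in the moving point
(inverse_cocoercive).  That this preimage exists rests on sigma-convex-concavity
and delta < 1/[-sigma]_+, which make W strongly monotone with constant
1/delta + sigma > 0 (strongly_monotone); in finite dimension strong monotonicity
gives surjectivity, by minimizing |W z - w|^2 over z
(strongly_monotone_surjective).  Monotonicity in the path parameter is deduced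
from local slopes (local_slope_le), which avoids differentiating W^-1. *)

Set Implicit Arguments.
Unset Strict Implicit.

(** * Euclidean inner product *)

Section Dot.
Context {R : realType} {d : nat}.
Implicit Types (u v w : 'rV[R]_d) (c : R).

Lemma dotvE u v : dotv u v = (u *m v^T) 0 0.
Proof. by rewrite mxE; apply: eq_bigr => i _; rewrite mxE. Qed.

Lemma dotvC u v : dotv u v = dotv v u.
Proof. by apply: eq_bigr => i _; rewrite mulrC. Qed.

Lemma dotvDl u v w : dotv (u + v) w = dotv u w + dotv v w.
Proof. by rewrite !dotvE mulmxDl mxE. Qed.

Lemma dotvZl c u w : dotv (c *: u) w = c * dotv u w.
Proof. by rewrite !dotvE -scalemxAl mxE. Qed.

Lemma dotvNl u w : dotv (- u) w = - dotv u w.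
Proof. by rewrite -scaleN1r dotvZl mulN1r. Qed.

Lemma dotvDr u v w : dotv w (u + v) = dotv w u + dotv w v.
Proof. by rewrite dotvC dotvDl !(dotvC w). Qed.

Lemma dotvZr c u w : dotv w (c *: u) = c * dotv w u.
Proof. by rewrite dotvC dotvZl (dotvC w). Qed.

Lemma dotvNr u w : dotv w (- u) = - dotv w u.
Proof. by rewrite dotvC dotvNl (dotvC w). Qed.

Lemma dotv0l w : dotv 0 w = 0.
Proof. by rewrite -(scale0r 0) dotvZl mul0r. Qed.

Lemma dotv_ge0 u : 0 <= dotv u u.
Proof. by apply: sumr_ge0 => i _; rewrite -expr2 sqr_ge0. Qed.

Lemma dotv_eq0 u : (dotv u u == 0) = (u == 0).
Proof.
apply/eqP/eqP => [u0|->]; last exact: dotv0l.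
apply/rowP => i; rewrite mxE; apply/eqP.
rewrite -sqrf_eq0 expr2; apply/eqP; move: i isT.
by apply: psumr_eq0P => // i _; rewrite -expr2 sqr_ge0.
Qed.

Lemma sqr_coord_le u i : u 0 i ^+ 2 <= dotv u u.
Proof.
rewrite /dotv (bigD1 i)//= expr2 lerDl.
by apply: sumr_ge0 => j _; rewrite -expr2 sqr_ge0.
Qed.

(** Young's inequality replaces Cauchy-Schwarz throughout: it is polynomial in the
inner products, so that no square root is ever taken. *)
Lemma dotv_young c u v : 0 < c -> 2 * dotv u v <= c * dotv u u + c^-1 * dotv v v.
Proof.
move=> c0; have := dotv_ge0 (c *: u - v).
rewrite !(dotvDl, dotvDr, dotvNl, dotvNr, dotvZl, dotvZr) (dotvC v u) => h.
rewrite -(ler_pM2l c0) mulrDr mulVKf ?gt_eqF//; lra.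
Qed.

(** How first-order remainders v are absorbed: |v| <= c |w| makes the cross term
with v of order c. *)
Lemma dotv_small c u v w : 0 < c -> dotv v v <= c ^+ 2 * dotv w w ->
  `|2 * dotv u v| <= c * (dotv u u + dotv w w).
Proof.
move=> c0 vw.
have h : c^-1 * dotv v v <= c * dotv w w.
  by rewrite -(ler_pM2l c0) mulVKf ?gt_eqF// mulrA -expr2.
have h1 := dotv_young u v c0; have h2 := dotv_young (- u) v c0.
move: h2; rewrite !(dotvNl, dotvNr) opprK => h2.
by rewrite ler_norml; apply/andP; split; lra.
Qed.

(** The polynomial form of Cauchy-Schwarz for strongly monotone maps:
expand |v - c u|^2 >= 0. *)
Lemma dotv_sq_le c u v : 0 <= c -> c * dotv u u <= dotv v u ->
  c ^+ 2 * dotv u u <= dotv v v.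
Proof.
move=> c0 h; have := dotv_ge0 (v - c *: u).
rewrite !(dotvDl, dotvDr, dotvNl, dotvNr, dotvZl, dotvZr) (dotvC u v).
have := ler_wpM2l c0 h; nra.
Qed.

Lemma dotvD_sq u v :
  dotv (u + v) (u + v) = dotv u u + 2 * dotv u v + dotv v v.
Proof. by rewrite !(dotvDl, dotvDr) (dotvC v u); ring. Qed.

(** The differential calculus on row vectors uses the sup norm; these two bounds
convert it to the Euclidean one. *)
Lemma dotv_normr u : dotv u u <= d%:R * `|u| ^+ 2.
Proof.
rewrite /dotv (le_trans (ler_sum _ (G := fun=> `|u| ^+ 2) _))//; last first.
  by rewrite sumr_const card_ord mulr_natl.
move=> i _; rewrite -expr2 -real_normK ?num_real// lerXn2r ?nnegrE//.
by rewrite [leRHS]/Num.Def.normr/= mx_normrE; apply/bigmax_geP; right; exists (0, i).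
Qed.

Lemma normr_dotv u : `|u| ^+ 2 <= dotv u u.
Proof.
rewrite [`|u|]/Num.Def.normr/=.
have [->|/mx_norm_neq0[[i j] ->]] := eqVneq (mx_norm u) 0.
  by rewrite expr0n dotv_ge0.
by rewrite ord1/= real_normK ?num_real// sqr_coord_le.
Qed.

End Dot.

Lemma dotv_mulmxl (R : realType) (d e : nat) (u : 'rV[R]_d) (A : 'M[R]_(d, e)) v :
  dotv (u *m A) v = dotv u (v *m A^T).
Proof. by rewrite !dotvE trmx_mul trmxK mulmxA. Qed.

Lemma dotv_row_mx (R : realType) (n m : nat) (a c : 'rV[R]_n) (b e : 'rV[R]_m) :
  dotv (row_mx a b) (row_mx c e) = dotv a c + dotv b e.
Proof. by rewrite !dotvE tr_row_mx mul_row_col mxE. Qed.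

(** * Coercive and saddle-structured matrices *)

Section Matrices.
Context {R : realType}.

Definition coercive d (k : R) (A : 'M[R]_d) :=
  forall u : 'rV[R]_d, k * dotv u u <= dotv (u *m A) u.

Lemma loewner_geP d k (A : 'M[R]_d) : loewner_ge A k%:M <-> coercive k A.
Proof.
by split=> h u; have := h u; rewrite -dotvE mulmxBr mul_mx_scalar dotvDl dotvNl
  dotvZl subr_ge0.
Qed.

Lemma coerciveD_scalar d c k (A : 'M[R]_d) :
  coercive k A -> coercive (c + k) (c%:M + A).
Proof.
move=> h u; rewrite mulmxDr mul_mx_scalar dotvDl dotvZl mulrDl lerD2l; exact: h.
Qed.

Lemma coercive_unitmx d k (A : 'M[R]_d) : 0 < k -> coercive k A -> A \in unitmx.
Proof.
move=> k0 h; rewrite -row_free_unit -kermx_eq0.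
apply/eqP/row_matrixP => i; rewrite row0; apply/eqP; rewrite -dotv_eq0.
have := h (row i (kermx A)); rewrite -row_mul mulmx_ker row0 dotv0l.
by rewrite pmulr_rle0// eq_le dotv_ge0 andbT.
Qed.

(** Expand |u A - k u|^2 >= 0. *)
Lemma coercive_inverse_cocoercive d k (A : 'M[R]_d) u : 0 <= k -> coercive k A ->
  k * dotv (u *m A) u <= dotv (u *m A) (u *m A).
Proof.
move=> k0 h; have := dotv_ge0 (u *m A - k *: u).
rewrite !(dotvDl, dotvDr, dotvNl, dotvNr, dotvZl, dotvZr) (dotvC u (u *m A)).
have := ler_wpM2l k0 (h u); nra.
Qed.

Section Saddle.
Variables (n m : nat) (P : 'M[R]_n) (B : 'M[R]_(n, m)) (Q : 'M[R]_m) (k kappa : R).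
Hypotheses (Psym : P^T = P) (Qsym : Q^T = Q) (k0 : 0 < k) (kappa0 : 0 < kappa).
Hypotheses (Pk : coercive k P) (Qk : coercive k Q).
Let L := block_mx P (- B) B^T Q.

(** The off-diagonal blocks cancel in the quadratic form of L. *)
Lemma saddle_block_coercive : coercive k L.
Proof.
move=> u; rewrite -(hsubmxK u); set p := lsubmx u; set q := rsubmx u.
rewrite /L mul_row_block !dotv_row_mx mulmxN !(dotvDl, dotvNl).
rewrite (dotv_mulmxl p B) (dotv_mulmxl q B^T) trmxK (dotvC q) -dotv_mulmxl.
have := Pk p; have := Qk q; rewrite dotv_mulmxl dotvC; lra.
Qed.

Hypothesis S1 : coercive kappa (P + B *m invmx Q *m B^T).
Hypothesis S2 : coercive kappa (Q + B^T *m invmx P *m B).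

(** With u = h L = (u1, u2), block elimination writes h as the sum of the
solutions (p1, q1) and (p2, q2) for the right-hand sides (u1, 0) and (0, u2).
Here p1 and q2 are the images of u1 and u2 under the inverse Schur complements.
The opposite signs of the off-diagonal blocks make the cross terms <u1, p2> and
<u2, q1> cancel, so <u, h> splits into <u1, p1> + <u2, q2>, and each summand is
controlled by the coercivity of its Schur complement. *)
Lemma saddle_block_inverse_cocoercive h :
  kappa * dotv (h *m L) h <= dotv (h *m L) (h *m L).
Proof.
have Pu := coercive_unitmx k0 Pk; have Qu := coercive_unitmx k0 Qk.
have Lu := coercive_unitmx k0 saddle_block_coercive.
have S1u := coercive_unitmx kappa0 S1; have S2u := coercive_unitmx kappa0 S2.
have T1c := S1; have T2c := S2.
set T1 := (P + _) in T1c S1u; set T2 := (Q + _) in T2c S2u.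
set u1 := lsubmx (h *m L); set u2 := rsubmx (h *m L).
pose p1 := u1 *m invmx T1; pose q1 := p1 *m B *m invmx Q.
pose q2 := u2 *m invmx T2; pose p2 := - (q2 *m B^T *m invmx P).
have E1 : p1 *m P + q1 *m B^T = u1.
  by rewrite -[RHS](mulmxKV S1u) -/p1 mulmxDr !mulmxA.
have E2 : p1 *m B = q1 *m Q by rewrite /q1 mulmxKV.
have E3 : q2 *m Q - p2 *m B = u2.
  by rewrite -[RHS](mulmxKV S2u) -/q2 mulmxDr !mulmxA mulNmx opprK.
have E4 : p2 *m P = - (q2 *m B^T) by rewrite /p2 mulNmx mulmxKV.
(* L is invertible, so it suffices to compare the images under L. *)
have hE : h = row_mx (p1 + p2) (q1 + q2).
  apply: (can_inj (mulmxK Lu)); rewrite -[LHS]hsubmxK /L mul_row_block.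
  rewrite -/L -/u1 -/u2.
  rewrite !mulmxN !mulmxDl E2 E4 -{1}E1 -{1}E3.
  congr row_mx; first by rewrite [_ + q2 *m _]addrC addrA subrK.
  by rewrite opprD addrACA addNr add0r addrC.
have cross : dotv u1 p2 + dotv u2 q1 = 0.
  rewrite -E1 -E3 !(dotvDl, dotvNl) (dotv_mulmxl p1 P) Psym E4.
  rewrite (dotv_mulmxl q2 Q) Qsym -E2 dotvNr.
  rewrite (dotv_mulmxl q1) trmxK (dotvC (p2 *m B)).
  by rewrite (dotvC p1) (dotv_mulmxl q2) trmxK; ring.
have e1 : u1 = p1 *m T1 by rewrite mulmxKV.
have e2 : u2 = q2 *m T2 by rewrite mulmxKV.
have c1 : kappa * dotv u1 p1 <= dotv u1 u1.
  by rewrite e1; apply: coercive_inverse_cocoercive T1c; rewrite ltW.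
have c2 : kappa * dotv u2 q2 <= dotv u2 u2.
  by rewrite e2; apply: coercive_inverse_cocoercive T2c; rewrite ltW.
rewrite -[h *m L]hsubmxK -/u1 -/u2 [in leLHS]hE !dotv_row_mx !dotvDr.
suff -> : dotv u1 p1 + dotv u1 p2 + (dotv u2 q1 + dotv u2 q2) =
  dotv u1 p1 + dotv u2 q2 by lra.
by lra.
Qed.

End Saddle.
End Matrices.

Local Open Scope classical_set_scope.

(** * Euclidean differentiability *)

(** Frechet differentiability with the remainder measured in the squared Euclidean
norm, on an explicit ball.  The matrix L acts on row vectors from the right. *)
Definition has_jacobian (R : realType) (d e : nat) (W : 'rV[R]_d -> 'rV[R]_e)
    (z : 'rV[R]_d) (L : 'M[R]_(d, e)) :=
  forall eps, 0 < eps -> exists2 eta, 0 < eta &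
    forall h, dotv h h < eta ->
      dotv (W (z + h) - W z - h *m L) (W (z + h) - W z - h *m L)
        <= eps ^+ 2 * dotv h h.

Lemma differentiable_has_jacobian (R : realType) (d e : nat)
    (W : 'rV[R]_d -> 'rV[R]_e) z :
  differentiable W z -> has_jacobian W z ('J W z).
Proof.
move=> dW eps eps0.
(* Passing from the sup norm to the Euclidean norm costs a factor e <= e.+1 ^ 2. *)
pose c := eps / e.+1%:R.
have c0 : 0 < c by rewrite divr_gt0.
have /eqaddoP/(_ _ c0) := diff_locally dW.
move=> /nbhs_ballP[r /= r0 Hr]; exists (r ^+ 2); first by rewrite exprn_gt0.
move=> h hr.
have {}hr : `|h| < r.
  rewrite -(@ltr_pXn2r _ 2)// ?nnegrE// ?(ltW r0)//.
  exact: le_lt_trans (normr_dotv h) hr.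
have {Hr} := Hr h; rewrite -ball_normE /= sub0r normrN => /(_ hr).
set v := (X in `|X| <= _).
have -> : v = W (z + h) - W z - h *m 'J W z.
  rewrite /v /= -deriveEjacobian// deriveE//.
  by rewrite -[in RHS](addrC h) opprD addrA.
move: (W _ - _ - _) => {}v vh.
apply: le_trans (dotv_normr v) _.
have : `|v| ^+ 2 <= c ^+ 2 * dotv h h.
  apply: (@le_trans _ _ ((c * `|h|) ^+ 2)).
    by rewrite lerXn2r ?nnegrE// mulr_ge0// ltW.
  by rewrite exprMn ler_wpM2l ?normr_dotv// exprn_ge0// ltW.
move=> /(ler_wpM2l (ler0n _ e))/le_trans; apply.
rewrite mulrA ler_wpM2r ?dotv_ge0//.
rewrite /c exprMn mulrCA ger_pMr ?exprn_gt0// exprVn ler_pdivrMr ?exprn_gt0//.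
rewrite mul1r -natrX ler_nat -[leqLHS]muln1 expnS leq_mul//.
Qed.

(** * Integrating a pointwise inequality *)

(** A function all of whose local slopes are at least - eps, for every eps, is
nondecreasing.  After adding
eps * t the local slopes are nonnegative, and the supremum of the points t where
the value is at least the value at 0 can only be 1. *)
Lemma local_slope_le (R : realType) (f : R -> R) :
  (forall eps, 0 < eps -> forall t, exists2 eta, 0 < eta &
     forall s, `|s - t| < eta -> - (eps * (s - t) ^+ 2) <= (s - t) * (f s - f t)) ->
  f 0 <= f 1.
Proof.
move=> Hf; apply/ler_addgt0Pr => eps eps0.
pose g t := f t + eps * t.
suff : g 0 <= g 1 by rewrite /g; lra.
have {}Hf t : exists2 eta, 0 < eta &
    forall s, `|s - t| < eta -> 0 <= (s - t) * (g s - g t).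
  have [eta eta0 H] := Hf eps eps0 t; exists eta => // s /H.
  by rewrite /g expr2; lra.
pose S := [set t | 0 <= t <= 1 /\ g 0 <= g t].
have S0 : S 0 by split; rewrite ?lexx ?ler01.
have S1 : ubound S 1 by move=> t [/andP[]].
have supS : has_sup S by split; [exists 0|exists 1].
set c := sup S.
have c0 : 0 <= c by apply: ub_le_sup => //; exists 1.
have c1 : c <= 1 by apply: ge_sup => //; exists 0.
have [eta eta0 H] := Hf c.
have [t [t01 gt] ct] := sup_adherent eta0 supS.
have tc : t <= c by apply: ub_le_sup; [exists 1|split].
have gc : g 0 <= g c.
  have [->//|tnc] := eqVneq c t.
  have {}tc : t < c by rewrite lt_neqAle eq_sym tnc.
  have := H t; rewrite ltr0_norm ?subr_lt0// opprB nmulr_rge0 ?subr_lt0//.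
  by rewrite subr_le0 => /(_ _)/(le_trans gt); apply; rewrite -/c in ct; lra.
have [-> //|cn1] := eqVneq 1 c.
have {}c1 : c < 1 by rewrite lt_neqAle eq_sym cn1.
pose s := Num.min 1 (c + eta / 2).
have cs : c < s by rewrite lt_min c1/=; lra.
have s1 : s <= 1 by rewrite ge_min lexx.
have sc : s <= c + eta / 2 by rewrite ge_min lexx orbT.
have : s <= c.
  apply: ub_le_sup; first by exists 1.
  split; first by apply/andP; split => //; lra.
  apply: (le_trans gc); have := H s.
  rewrite gtr0_norm ?subr_gt0// pmulr_rge0 ?subr_gt0// subr_ge0; apply; lra.
by rewrite leNgt cs.
Qed.

(** * Cocoercivity of the inverse of a strongly monotone map *)

Section Inverse.
Context {R : realType} {d : nat}.
Variables (W : 'rV[R]_d -> 'rV[R]_d) (L : 'rV[R]_d -> 'M[R]_d) (k : R).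
Hypotheses (k0 : 0 < k) (WL : forall z, has_jacobian W z (L z)).
Hypothesis Lk : forall z, coercive k (L z).

(** Apply local_slope_le to <W (z + t h), h> - k t |h|^2 with h = w - z. *)
Lemma strongly_monotone z w : k * dotv (w - z) (w - z) <= dotv (W w - W z) (w - z).
Proof.
set h := w - z.
pose f t := dotv (W (z + t *: h)) h - k * t * dotv h h.
suff : f 0 <= f 1.
  rewrite /f scale0r scale1r addr0 (_ : z + h = w); last by rewrite /h addrC subrK.
  by rewrite dotvDl dotvNl; lra.
clearbody h; apply: local_slope_le => eps eps0 t.
(* The inner product of the remainder with the increment is at most
   c (s - t)^2 |h|^2 <= eps (s - t)^2; the 1 is there in case h = 0. *)
pose c := eps / (1 + dotv h h).
have h1 : 0 < 1 + dotv h h by rewrite ltr_pwDl// dotv_ge0.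
have c0 : 0 < c by rewrite divr_gt0.
have [eta eta0 H] := WL (z + t *: h) c0.
exists (Num.min 1 (eta / (1 + dotv h h))).
  by rewrite lt_min ltr01 divr_gt0.
move=> s; rewrite lt_min => /andP[st1 st].
have {H} := H ((s - t) *: h).
have -> : z + t *: h + (s - t) *: h = z + s *: h.
  by rewrite -addrA -scalerDl subrKC.
set r := _ - _ *m _; rewrite dotvZl dotvZr.
have -> : f s - f t = dotv (W (z + s *: h) - W (z + t *: h)) h - k * (s - t) * dotv h h.
  by rewrite /f dotvDl dotvNl; ring.
have -> : W (z + s *: h) - W (z + t *: h) = r + (s - t) *: h *m L (z + t *: h).
  by rewrite /r subrK.
clearbody r.
have Lh := Lk (z + t *: h) h; rewrite dotvDl -scalemxAl dotvZl.
move: (dotv (h *m _) h) Lh => a Lh.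
have hh := dotv_ge0 h; move: st; rewrite ltr_pdivlMr// => st.
have st2 : (s - t) * ((s - t) * dotv h h) < eta.
  rewrite mulrA -expr2 -real_normK ?num_real//.
  apply: le_lt_trans st; apply: ler_pM; rewrite ?exprn_ge0//; last by lra.
  by rewrite expr2 ler_piMr// ltW.
move=> /(_ st2) rh.
have := @dotv_small _ _ c ((s - t) *: h) r ((s - t) *: h) c0.
rewrite !(dotvZl, dotvZr) => /(_ rh); rewrite ler_norml => /andP[+ _].
rewrite (dotvC h r).
have ch : c * dotv h h <= eps.
  by rewrite /c mulrAC ler_pdivrMr// ler_wpM2l ?(ltW eps0)//; lra.
set st' := s - t; have s2 : 0 <= st' * st' by rewrite -expr2 sqr_ge0.
have := ler_wpM2l s2 ch; have := ler_wpM2l s2 Lh.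
rewrite expr2; nra.
Qed.

Lemma dist_le_image_dist z w :
  k ^+ 2 * dotv (w - z) (w - z) <= dotv (W w - W z) (W w - W z).
Proof. by apply: dotv_sq_le (strongly_monotone z w); rewrite ltW. Qed.

(** At a minimizer z of |W z - w|^2 the residual r = W z - w vanishes: moving z in
the direction - r changes the square by - 2 t <r L, r> <= - 2 t k |r|^2 to first
order, which would be a decrease. *)
Lemma min_image_dist_eq w z :
  (forall z', dotv (W z - w) (W z - w) <= dotv (W z' - w) (W z' - w)) -> W z = w.
Proof.
move=> zmin; set r := W z - w; apply/eqP; rewrite -subr_eq0 -/r -dotv_eq0.
rewrite eq_le dotv_ge0 andbT leNgt; apply/negP => r0.
have k2 : 0 < k / 2 by rewrite divr_gt0.
have [eta eta0 H] := WL z k2.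
set rL := r *m L z.
(* 2 t^2 C bounds the second-order terms, with remainder tolerance k / 2; the step
   t is small enough for the first-order decrease to win. *)
pose C := dotv rL rL + k ^+ 2 / 4 * dotv r r.
have C0 : 0 < C.
  by rewrite ltr_wpDl ?dotv_ge0// mulr_gt0// divr_gt0// exprn_gt0.
pose t := Num.min 1 (Num.min (eta / (2 * dotv r r)) (k * dotv r r / (4 * C))).
have t0 : 0 < t.
  by rewrite !lt_min ltr01/= !divr_gt0// ?mulr_gt0.
have t1 : t <= 1 by rewrite ge_min lexx.
have te : t * (2 * dotv r r) <= eta.
  by rewrite -ler_pdivlMr ?mulr_gt0// !ge_min lexx/= orbT.
have tC : t * (4 * C) <= k * dotv r r.
  by rewrite -ler_pdivlMr ?mulr_gt0// !ge_min lexx/= !orbT.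
have {H} := H (- t *: r).
have := zmin (z - t *: r); rewrite scaleNr.
set a := W (z - t *: r) - W z.
have -> : W (z - t *: r) - w = r + a by rewrite /a /r [RHS]addrC subrKA.
rewrite [X in _ <= X]dotvD_sq -/r mulNmx -scalemxAl -/rL opprK => ra.
rewrite dotvNl dotvNr opprK dotvZl dotvZr => H.
have {H} := H _; set rho := a + t *: rL => H.
have {}H : dotv rho rho <= (k / 2) ^+ 2 * (t * (t * dotv r r)).
  by apply: H; have := mulr_gt0 t0 r0; nra.
have aE : a = rho - t *: rL by rewrite /rho addrK.
have h4 := Lk z r; rewrite -/rL in h4.
clearbody rho a rL r.
have h1 : dotv a a <= 2 * dotv rho rho + 2 * t ^+ 2 * dotv rL rL.
  have := dotv_ge0 (rho + t *: rL).
  rewrite aE !(dotvDl, dotvDr, dotvNl, dotvNr, dotvZl, dotvZr).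
  by rewrite (dotvC rL rho) expr2; lra.
have := @dotv_small _ _ (k / 2) (t *: r) rho (t *: r) k2.
rewrite !(dotvZl, dotvZr) => /(_ H); rewrite ler_norml => /andP[_ h2].
have h3 : 2 * dotv r rho <= k * (t * dotv r r).
  by rewrite -(ler_pM2l t0); lra.
have h5 : 2 * dotv r a <= k * (t * dotv r r) - 2 * t * (k * dotv r r).
  rewrite aE dotvDr dotvNr dotvZr (dotvC r rL).
  by have := ler_wpM2l (ltW t0) h4; lra.
have h6 : k * (t * dotv r r) <= 2 * t ^+ 2 * C.
  by rewrite /C; move: H; rewrite !expr2; lra.
have h7 : k * dotv r r <= 2 * t * C by rewrite -(ler_pM2l t0); move: h6; rewrite expr2; lra.
have : 0 < k * dotv r r by rewrite mulr_gt0.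
by lra.
Qed.

Hypothesis Wc : forall i, continuous (fun z => W z 0 i).

(** Strong monotonicity bounds the sublevel sets of |W z - w|^2, so a minimizer
exists. *)
Lemma strongly_monotone_surjective w : exists z, W z = w.
Proof.
pose g z := dotv (W z - w) (W z - w).
have gc : continuous g.
  rewrite /g /dotv; apply: continuous_big => //=; first exact: add_continuous.
  move=> i _ z; apply: continuousM.
    rewrite [X in {for _, continuous X}](_ : _ = (fun z => W z 0 i - w 0 i)).
      by apply: continuousB; [exact: Wc|exact: cst_continuous].
    by apply/funext => x; rewrite !mxE.
  rewrite [X in {for _, continuous X}](_ : _ = (fun z => W z 0 i - w 0 i)).
    by apply: continuousB; [exact: Wc|exact: cst_continuous].
  by apply/funext => x; rewrite !mxE.
pose K := [set z | g z <= g 0].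
have K0 : K 0 by rewrite /K/=.
have Kcl : closed K.
  have /continuous_closedP/(_ [set x | x <= g 0]) := gc.
  by apply; exact: closed_le.
have Kb : bounded_set K.
  exists (1 + 4 * g 0 / k ^+ 2); split; first exact: num_real.
  move=> M /ltW MM z Kz /=; apply: le_trans MM.
  have g0 : 0 <= 4 * g 0 / k ^+ 2.
    by rewrite divr_ge0 ?exprn_ge0 ?(ltW k0)// mulr_ge0// dotv_ge0.
  have zb : `|z| ^+ 2 <= 4 * g 0 / k ^+ 2.
    rewrite ler_pdivlMr ?exprn_gt0// mulrC.
    apply: le_trans (_ : k ^+ 2 * dotv z z <= _).
      by rewrite ler_wpM2l ?normr_dotv// exprn_ge0// ltW.
    have := dist_le_image_dist 0 z; rewrite subr0 => /le_trans; apply.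
    have -> : W z - W 0 = (W z - w) - (W 0 - w) by rewrite opprB addrA subrK.
    move: Kz; rewrite /K /g /=; move: (W z - w) (W 0 - w) => a b ab.
    have := dotv_ge0 (a + b).
    by rewrite !(dotvDl, dotvDr, dotvNl, dotvNr) (dotvC b a); lra.
  have [z1|z1] := leP `|z| 1; first by lra.
  suff : `|z| <= `|z| ^+ 2 by lra.
  by rewrite expr2 ler_pMr ?(ltW z1)// (lt_trans ltr01).
have [|z _ zmin] := EVT_min_rV _ (bounded_closed_compact Kb Kcl) (continuous_subspaceT gc).
  by exists 0.
have {}zmin z' : g z <= g z'.
  have [Kz'|] := pselect (K z'); first by apply: zmin; rewrite inE.
  move/negP; rewrite -ltNge => /ltW; apply: le_trans; apply: zmin.
  by rewrite inE.
by exists z; apply: min_image_dist_eq.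
Qed.

Variable kappa : R.
Hypothesis kappa0 : 0 <= kappa.
Hypothesis Lkappa : forall z h,
  kappa * dotv (h *m L z) h <= dotv (h *m L z) (h *m L z).

(** Let zeta t be the preimage of W z + t e with e = W w - W z, and apply
local_slope_le to t |e|^2 - kappa <e, zeta t>.  Between nearby parameters the
increment a = (s - t) e of W is h L plus a remainder, with h = zeta s - zeta t, so
that (s - t) times the increment of the function is |a|^2 - kappa <a, h>, which is
nonnegative up to the remainder by the hypothesis on L.  Strong monotonicity gives
k |h| <= |a|, so that the remainder is o((s - t)^2). *)
Lemma inverse_cocoercive z w :
  kappa * dotv (W w - W z) (w - z) <= dotv (W w - W z) (W w - W z).
Proof.
set e := W w - W z; have We : W z + e = W w by rewrite /e addrC subrK.
clearbody e; have [zeta zetaE] := choice (fun t : R => strongly_monotone_surjective (W z + t *: e)).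
have inj x y : W x = W y -> x = y.
  move=> xy; apply/eqP; rewrite -subr_eq0 -dotv_eq0 eq_le dotv_ge0 andbT.
  have := dist_le_image_dist y x; rewrite xy subrr dotv0l.
  by rewrite pmulr_rle0 ?exprn_gt0.
have z0 : zeta 0 = z by apply: inj; rewrite zetaE scale0r addr0.
have z1 : zeta 1 = w by apply: inj; rewrite zetaE scale1r We.
pose f t := t * dotv e e - kappa * dotv e (zeta t).
suff : f 0 <= f 1 by rewrite /f z0 z1 dotvDr dotvNr; lra.
apply: local_slope_le => eps eps0 t.
(* D collects the constants of the remainder estimate: the total error is at most
   c (s - t)^2 D, where the leading 1 keeps D positive when e = 0. *)
pose D := (1 + dotv e e) * (1 + (2 + kappa) / k ^+ 2).
have k2 : 0 < k ^+ 2 by rewrite exprn_gt0.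
have ee := dotv_ge0 e.
have q0 : 0 <= (2 + kappa) / k ^+ 2 by rewrite divr_ge0 ?addr_ge0 ?(ltW k2).
have D0 : 0 < D by rewrite mulr_gt0//; lra.
pose c := Num.min 1 (eps / D).
have c0 : 0 < c by rewrite lt_min ltr01 divr_gt0.
have c1 : c <= 1 by rewrite ge_min lexx.
have cD : c * D <= eps by rewrite -ler_pdivlMr// ge_min lexx orbT.
have [eta eta0 H] := WL (zeta t) c0.
(* |h|^2 <= (s - t)^2 |e|^2 / k^2 < eta when |s - t| < min 1 (eta / M). *)
pose M := 1 + dotv e e / k ^+ 2.
have eek : 0 <= dotv e e / k ^+ 2 by rewrite divr_ge0// ltW.
have M0 : 0 < M by rewrite /M; lra.
exists (Num.min 1 (eta / M)); first by rewrite lt_min ltr01 divr_gt0.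
move=> s; rewrite lt_min ltr_pdivlMr// => /andP[st1 st].
set h := zeta s - zeta t; set a := (s - t) *: e.
have aE : W (zeta s) - W (zeta t) = a.
  by rewrite !zetaE opprD addrACA subrr add0r -scalerBl.
have ha : k ^+ 2 * dotv h h <= dotv a a by rewrite -aE dist_le_image_dist.
have aa : dotv a a = (s - t) ^+ 2 * dotv e e.
  by rewrite dotvZl dotvZr expr2 mulrA.
have hM : dotv h h < eta.
  have : dotv h h <= (s - t) ^+ 2 * (dotv e e / k ^+ 2).
    by rewrite mulrA ler_pdivlMr// mulrC -aa.
  move/le_lt_trans; apply; apply: le_lt_trans st.
  rewrite -real_normK ?num_real//; apply: ler_pM; rewrite ?exprn_ge0//.
    by rewrite expr2 ler_piMr// ltW.
  by rewrite /M; lra.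
have := H h hM; rewrite {1 2}/h ![zeta t + _]addrC subrK aE.
set r := a - h *m _ => rh.
have hLE : h *m L (zeta t) = a - r by rewrite /r opprB addrC subrK.
have := Lkappa (zeta t) h; rewrite hLE.
have /ler_normlP[B1 _] := dotv_small a c0 rh.
have /ler_normlP[_ B2] := dotv_small h c0 rh.
have -> : (s - t) * (f s - f t) = dotv a a - kappa * dotv a h.
  by rewrite /f /a /h !(dotvZl, dotvZr) dotvDr dotvNr; ring.
clearbody r a h.
rewrite !(dotvDl, dotvDr, dotvNl, dotvNr) (dotvC r a) (dotvC r h) => key.
have hh := dotv_ge0 h.
have c2 : dotv r r <= c * dotv h h.
  by apply: (le_trans rh); rewrite ler_wpM2r// expr2 ler_piMr// ltW.
have B4 : kappa * (2 * dotv h r) <= kappa * (c * (dotv h h + dotv h h)).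
  by rewrite ler_wpM2l.
have B5 : dotv h h <= dotv a a / k ^+ 2 by rewrite ler_pdivlMr// mulrC.
have B6 : c * ((2 + kappa) * dotv h h) <= c * ((2 + kappa) * (dotv a a / k ^+ 2)).
  by rewrite ler_wpM2l ?(ltW c0)// ler_wpM2l// addr_ge0.
have B7 : (s - t) ^+ 2 * (c * D) <= (s - t) ^+ 2 * eps.
  by rewrite ler_wpM2l ?sqr_ge0.
have B8 : dotv a a * (1 + (2 + kappa) / k ^+ 2) <= (s - t) ^+ 2 * D.
  rewrite aa -mulrA ler_wpM2l ?sqr_ge0// /D ler_wpM2r//; lra.
have B9 := ler_wpM2l (ltW c0) B8.
have E1 : (2 + kappa) * (dotv a a / k ^+ 2) = dotv a a * ((2 + kappa) / k ^+ 2).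
  by rewrite mulrCA.
rewrite E1 in B6; lra.
Qed.
End Inverse.

(** * Symmetry of the Hessian *)

Section Schwarz.
Context {R : realType} {d : nat}.
Variable f : 'rV[R]_d -> R.
Hypothesis df : forall z, differentiable f z.
Let e (i : 'I_d) : 'rV[R]_d := delta_mx 0 i.

Lemma is_derive_line z v (s : R) :
  is_derive s 1 (fun s => f (z + s *: v)) ('D_v f (z + s *: v)).
Proof.
have E : (fun h : R => h^-1 *: (((fun s => f (z + s *: v)) \o shift s) (h *: 1)
            - f (z + s *: v)))
       = (fun h : R => h^-1 *: ((f \o shift (z + s *: v)) (h *: v) - f (z + s *: v))).
  apply/funext => h /=; congr (_ *: (f _ - _)).
  by rewrite [h *: 1]mulr1 scalerDl addrCA.
apply: DeriveDef; last by rewrite /derive E.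
by rewrite /derivable E; exact: diff_derivable.
Qed.

(** Young's argument: by the mean value theorem in direction i the second
difference is t times a difference of gradients at two points within O(t) of z, and
differentiability of the gradient at z turns it into t^2 H j i + o(t^2). *)
Lemma second_difference z (H : 'M[R]_d) i j eps :
  has_jacobian (gradient f) z H -> 0 < eps ->
  exists2 eta, 0 < eta & forall t, 0 < t < eta ->
    `|f (z + t *: e i + t *: e j) - f (z + t *: e i) - f (z + t *: e j) + f z
      - t ^+ 2 * H j i| <= eps * t ^+ 2.
Proof.
move=> dH eps0.
have c0 : 0 < eps / 4 by rewrite divr_gt0.
have [eta eta0 Heta] := dH _ c0.
exists (Num.min 1 (eta / 4)); first by rewrite lt_min ltr01 divr_gt0.
move=> t /andP[t0]; rewrite lt_min => /andP[t1 te].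
pose g s := f (z + t *: e j + s *: e i) - f (z + s *: e i).
pose dg s := gradient f (z + t *: e j + s *: e i) 0 i - gradient f (z + s *: e i) 0 i.
have gdg (s : R) : is_derive s 1 g (dg s).
  by rewrite /dg /gradient !mxE; apply: is_deriveB; exact: is_derive_line.
have gc : {within `[0, t], continuous g}.
  apply: continuous_subspaceT => s; apply/differentiable_continuous.
  by apply/derivable1_diffP; have [] := gdg s.
have [s /[!in_itv]/= /andP[s0 st] gs] := MVT t0 (fun s _ => gdg s) gc.
have ee l : dotv (e l) (e l) = 1.
  by rewrite dotvE trmx_delta mul_delta_mx mxE.
have tt : 4 * t ^+ 2 < eta.
  have : t ^+ 2 <= t by rewrite expr2 ler_piMr// ltW.
  by lra.
have ss : s ^+ 2 <= t ^+ 2 by rewrite lerXn2r ?nnegrE ?ltW.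
(* Both points at which the gradient is expanded are within 2 t of z, so each
   remainder is at most 2 t (eps / 4). *)
have small h : dotv h h <= 4 * t ^+ 2 ->
    `|(gradient f (z + h) - gradient f z - h *m H) 0 i| <= eps / 2 * t.
  move=> ht; have := Heta h (le_lt_trans ht tt); set r := _ - _ *m _ => rh.
  rewrite -(@ler_pXn2r _ 2)// ?nnegrE ?mulr_ge0 ?divr_ge0 ?(ltW eps0) ?(ltW t0)//.
  rewrite real_normK ?num_real//.
  apply: le_trans (sqr_coord_le r i) _; apply: le_trans rh _.
  apply: le_trans (ler_wpM2l (sqr_ge0 _) ht) _.
  by rewrite le_eqVlt; apply/orP; left; apply/eqP; field.
have n1 : dotv (t *: e j + s *: e i) (t *: e j + s *: e i) <= 4 * t ^+ 2.
  rewrite dotvD_sq; have := dotv_young (t *: e j) (s *: e i) ltr01.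
  rewrite invr1 !mul1r; move: (dotv (t *: e j) (s *: e i)) => x.
  rewrite !(dotvZl, dotvZr) !ee !mulr1 -!expr2; lra.
have n2 : dotv (s *: e i) (s *: e i) <= 4 * t ^+ 2.
  rewrite !(dotvZl, dotvZr) !ee !mulr1 -!expr2.
  by have := sqr_ge0 t; lra.
have := small _ n1; have := small _ n2.
rewrite addrA mulmxDl -(scalemxAl t) -rowE.
have -> : f (z + t *: e i + t *: e j) - f (z + t *: e i) - f (z + t *: e j) + f z
    = dg s * t.
  rewrite -[t in RHS]subr0 -gs /g !scale0r !addr0.
  by rewrite [z + _ + t *: e i]addrAC; ring.
rewrite /dg; move: (gradient f _) (gradient f _) (gradient f _) => G1 G2 G3.
move: (s *: e i *m H) => v; rewrite !mxE.
set x := (X in `|X| <= _) => xb; set y := (X in `|X| <= _) => yb.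
set q := (X in `|X|).
have -> : q = t * (y - x) by rewrite /q /x /y; ring.
rewrite normrM gtr0_norm// expr2 mulrCA ler_pM2l//.
by apply: le_trans (ler_normB _ _) _; lra.
Qed.

(** The second difference is symmetric in i and j, while second_difference
expands it with leading coefficient H j i or H i j. *)
Lemma hessian_sym z : differentiable (gradient f) z ->
  (hessian f z)^T = hessian f z.
Proof.
move=> /differentiable_has_jacobian dH; apply/matrixP => i j; rewrite mxE.
set H := hessian f z; apply/eqP; rewrite -subr_eq0 -normr_le0.
apply/ler_addgt0Pr => eps eps0; rewrite add0r.
have e2 : 0 < eps / 2 by rewrite divr_gt0.
have [a a0 Ha] := second_difference i j dH e2.
have [b b0 Hb] := second_difference j i dH e2.
pose t := Num.min a b / 2.
have m0 : 0 < Num.min a b by rewrite lt_min a0.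
have ma : Num.min a b <= a by rewrite ge_min lexx.
have mb : Num.min a b <= b by rewrite ge_min lexx orbT.
have t0 : 0 < t by rewrite /t; lra.
have ta : 0 < t < a by rewrite t0/= /t; lra.
have tb : 0 < t < b by rewrite t0/= /t; lra.
have := Hb t tb; have := Ha t ta.
rewrite [z + _ + t *: e j]addrAC -/(hessian f z) -/H.
rewrite -[in _ <= eps](ler_pM2l (exprn_gt0 2 t0)) -[X in X * `|_|]gtr0_norm ?exprn_gt0//.
rewrite -normrM !ler_norml => /andP[h1 h2] /andP[h3 h4].
by apply/andP; split; lra.
Qed.

End Schwarz.

Local Close Scope classical_set_scope.

(** * The shifted saddle operator *)

(** The sign change turning the gradient into the saddle operator.  It is a
Euclidean isometry, so it preserves the size of first-order remainders. *)
Definition flip_y (R : realType) (n m : nat) (v : 'rV[R]_(n + m)) : 'rV[R]_(n + m) :=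
  row_mx (lsubmx v) (- rsubmx v).

Lemma flip_yB (R : realType) (n m : nat) (u v : 'rV[R]_(n + m)) :
  flip_y (u - v) = flip_y u - flip_y v.
Proof. by rewrite /flip_y opp_row_mx add_row_mx !linearB. Qed.

Section ShiftedSaddle.
Context {R : realType} {n m : nat}.
Implicit Types (phi : 'rV[R]_(n + m) -> \bar R) (z : 'rV[R]_(n + m)).

Definition saddle_map phi z := flip_y (gradient (fine \o phi) z).

Definition shifted_saddle phi (delta : R) z := delta^-1 *: z + saddle_map phi z.

Definition shifted_saddle_jacobian phi (delta : R) z :=
  block_mx ((delta^-1)%:M + hess_xx phi z) (- hess_xy phi z)
    (hess_xy phi z)^T ((delta^-1)%:M - hess_yy phi z).

Variables (phi : 'rV[R]_(n + m) -> \bar R) (sigma alpha delta : R).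
Hypothesis phi_C2 : twice_continuously_differentiable phi.
Let F := saddle_map phi.
Let W := shifted_saddle phi delta.
Let L := shifted_saddle_jacobian phi delta.

Lemma hess_xx_sym z : (hess_xx phi z)^T = hess_xx phi z.
Proof.
by case: phi_C2 => _ df dg _; rewrite /hess_xx trmx_ulsub hessian_sym.
Qed.

Lemma hess_yy_sym z : (hess_yy phi z)^T = hess_yy phi z.
Proof.
by case: phi_C2 => _ df dg _; rewrite /hess_yy trmx_drsub hessian_sym.
Qed.

Lemma hess_xy_tr z : (hess_xy phi z)^T = hess_yx phi z.
Proof.
by case: phi_C2 => _ df dg _; rewrite /hess_xy /hess_yx trmx_ursub hessian_sym.
Qed.

Lemma shifted_saddle_has_jacobian z : has_jacobian W z (L z).
Proof.
move=> eps eps0; case: phi_C2 => _ _ dg _.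
have [eta eta0 H] := differentiable_has_jacobian (dg z) eps0.
exists eta => // h /H; rewrite -/(hessian _ z); set r := _ - _ *m _ => rh.
have hL : h *m L z = delta^-1 *: h + flip_y (h *m hessian (fine \o phi) z).
  rewrite /flip_y /L /shifted_saddle_jacobian hess_xy_tr /hess_xx /hess_xy /hess_yx /hess_yy.
  rewrite -[in RHS](submxK (hessian _ z)) -(hsubmxK h) !mul_row_block.
  rewrite row_mxKl row_mxKr scale_row_mx add_row_mx !mulmxDr !mul_mx_scalar.
  by rewrite !mulmxN -addrA [X in row_mx _ X = _]addrCA -opprD.
have -> : W (z + h) - W z - h *m L z = flip_y r.
  rewrite hL /r !flip_yB /W /shifted_saddle /saddle_map.
  move: (flip_y _) (flip_y _) (flip_y _) => a b c.
  rewrite scalerDr !opprD.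
  by rewrite [LHS](AC ((3*2)*2) (((1*4)*(2*6))*(3*5*7)))/= !subrr !add0r.
rewrite /flip_y dotv_row_mx dotvNl dotvNr opprK -dotv_row_mx hsubmxK.
exact: rh.
Qed.

Lemma shifted_saddle_continuous i : continuous (fun z => W z 0 i).
Proof.
case: phi_C2 => _ _ dg _.
have gc (j : 'I_(n + m)) : continuous (fun z => gradient (fine \o phi) z 0 j).
  move=> z; apply: (@continuous_comp _ _ _ (gradient (fine \o phi)) (fun v => v 0 j)).
    exact: differentiable_continuous.
  exact: coord_continuous.
have Fc : continuous (fun z => F z 0 i).
  rewrite /F /saddle_map /flip_y; case: (split_ordP i) => j ->.
    under eq_fun do rewrite row_mxEl mxE.
    exact: gc.
  rewrite [X in continuous X](_ : _ =
      (fun z => - gradient (fine \o phi) z 0 (rshift n j))).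
    by move=> z; apply: continuousN (gc _ z).
  by apply/funext => z; rewrite row_mxEr 2!mxE.
rewrite /W /shifted_saddle [X in continuous X](_ : _ =
    (fun z : 'rV[R]_(n + m) => delta^-1 * z 0 i + F z 0 i)).
  move=> z; have c : {for z, continuous (fun z : 'rV[R]_(n + m) => delta^-1 * z 0 i)}.
    by apply: continuousM; [exact: cst_continuous|exact: coord_continuous].
  exact: cvgD c (Fc z).
by apply/funext => z; rewrite 2!mxE.
Qed.

Hypotheses (delta_sigma : 0 < delta^-1 + sigma) (delta_alpha : 0 < delta^-1 + alpha).
Hypothesis phi_cc : convex_concave sigma phi.
Let k := delta^-1 + sigma.
Let kappa := delta^-1 + alpha.

Let Pk z : coercive k ((delta^-1)%:M + hess_xx phi z).
Proof. by apply: coerciveD_scalar; apply/loewner_geP; case: (phi_cc z). Qed.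

Let Qk z : coercive k ((delta^-1)%:M - hess_yy phi z).
Proof. by apply: coerciveD_scalar; apply/loewner_geP; case: (phi_cc z). Qed.

Lemma shifted_saddle_jacobian_coercive z : coercive k (L z).
Proof. exact: saddle_block_coercive. Qed.

Lemma shifted_saddle_monotone z w : 0 <= dotv (W w - W z) (w - z).
Proof.
apply: le_trans (strongly_monotone shifted_saddle_has_jacobian
  shifted_saddle_jacobian_coercive z w).
by rewrite mulr_ge0 ?dotv_ge0// ltW.
Qed.

Hypothesis phi_dom : interaction_dominance alpha delta phi.

Lemma shifted_saddle_jacobian_inverse_cocoercive z h :
  kappa * dotv (h *m L z) h <= dotv (h *m L z) (h *m L z).
Proof.
apply: (saddle_block_inverse_cocoercive (k := k)) => //.
- by rewrite linearD/= tr_scalar_mx hess_xx_sym.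
- by rewrite linearB/= tr_scalar_mx hess_yy_sym.
- rewrite hess_xy_tr -addrA; apply: coerciveD_scalar.
  by apply/loewner_geP; case: (phi_dom z).
- rewrite hess_xy_tr -addrA; apply: coerciveD_scalar.
  by apply/loewner_geP; case: (phi_dom z).
Qed.

Lemma shifted_saddle_inverse_cocoercive z w :
  kappa * dotv (W w - W z) (w - z) <= dotv (W w - W z) (W w - W z).
Proof.
exact: (inverse_cocoercive delta_sigma shifted_saddle_has_jacobian
  shifted_saddle_jacobian_coercive shifted_saddle_continuous (ltW delta_alpha)
  shifted_saddle_jacobian_inverse_cocoercive).
Qed.

End ShiftedSaddle.

(** This is where the reading 1/0 = +oo matters: for sigma >= 0 the bound on delta
is void and both summands already have the right sign. *)
Lemma inv_delta_sigma_gt0 (R : realType) (sigma delta : R) :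
  0 < delta -> (delta%:E < ((pos_part (- sigma))%:E)^-1)%E -> 0 < delta^-1 + sigma.
Proof.
move=> d0; rewrite inver /pos_part.
have [s0 _|s0] := leP (- sigma) 0.
  by rewrite ltr_wpDr ?invr_gt0//; lra.
rewrite gt_eqF// lte_fin => h.
have : - sigma < delta^-1 by rewrite -[ltLHS]invrK ltf_pV2 ?posrE ?invr_gt0.
by lra.
Qed.

Unset Implicit Arguments.
Set Strict Implicit.

(* Inversion on \bar R satisfies 0%:E^-1 = +oo, so the bound on delta is void
   when pos_part (- sigma) = 0. *)
Theorem proposition4p17 (R : realType) (n m : nat)
    (phi : 'rV[R]_(n + m) -> \bar R) (sigma alpha delta : R)
    (phi_ninfty : forall z, phi z <> -oo%E)
    (phi_C2 : twice_continuously_differentiable phi)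
    (phi_cc : convex_concave sigma phi)
    (delta_gt0 : 0 < delta)
    (delta_lt : (delta%:E < ((pos_part (- sigma))%:E)^-1)%E)
    (alpha_gt : - (1 / delta) < alpha)
    (phi_dom : interaction_dominance alpha delta phi) :
  (alpha < 1 / delta ->
     semimonotone (alpha / (1 - alpha * delta))
       (- (delta / (1 - alpha * delta))) (saddle_operator phi)) /\
  (0 <= alpha -> semimonotone 0 (- delta) (saddle_operator phi)).
Proof.
have k0 : 0 < delta^-1 + sigma by exact: inv_delta_sigma_gt0.
have kappa0 : 0 < delta^-1 + alpha by move: alpha_gt; rewrite div1r; lra.
have di : delta^-1 * delta = 1 by rewrite mulVf ?gt_eqF.
have WE z w : shifted_saddle phi delta w - shifted_saddle phi delta z
    = delta^-1 *: (w - z) + (saddle_map phi w - saddle_map phi z).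
  by rewrite /shifted_saddle opprD addrACA -scalerBr.
split=> [alpha_lt|alpha0] z _ w _ -> ->;
  rewrite -/(saddle_map phi z) -/(saddle_map phi w);
  have := shifted_saddle_inverse_cocoercive phi_C2 k0 kappa0 phi_cc phi_dom w z;
  have := shifted_saddle_monotone phi_C2 k0 phi_cc w z; rewrite WE;
  move: (z - w) (saddle_map phi z - saddle_map phi w) => a b;
  rewrite !(dotvDl, dotvDr, dotvZl, dotvZr) (dotvC b a);
  move: (dotv a a) (dotv a b) (dotv b b) => x y u.
  move=> _ key; have c0 : 0 < 1 - alpha * delta.
    by move: alpha_lt; rewrite ltr_pdivlMr// subr_gt0.
  have -> : alpha / (1 - alpha * delta) * x + - (delta / (1 - alpha * delta)) * u
      = (alpha * x - delta * u) / (1 - alpha * delta) by ring.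
  rewrite ler_pdivrMr//.
  have : alpha * (delta^-1 * x) <= delta^-1 * y - alpha * y + u.
    by move: key; lra.
  move=> /(ler_wpM2l (ltW delta_gt0)).
  have -> : delta * (alpha * (delta^-1 * x)) = (delta^-1 * delta) * (alpha * x) by ring.
  have -> : delta * (delta^-1 * y - alpha * y + u)
    = (delta^-1 * delta) * y - delta * alpha * y + delta * u by ring.
  by rewrite di; lra.
move=> mono key.
have : 0 <= delta^-1 * y + u.
  have := mulr_ge0 alpha0 mono; move: key; lra.
move=> /(mulr_ge0 (ltW delta_gt0)).
by rewrite mulrDr mulrA mulfV ?gt_eqF//; lra.
Qed.
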